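(* For each $n\in\mathbb{N}$ (i.e. each integer $n\geqslant 1$), there is a finite non-commutative completely $0$-simple semigroup whose commuting graph has chromatic number equal to $n$.
   Context: A semigroup $S$ with a zero $0$ is completely $0$-simple if it is $0$-simple (it is not a null semigroup and its only ideals are $\{0\}$ and $S$) and it contains a primitive idempotent (an idempotent that is minimal among the non-zero idempotents, in the natural partial order of idempotents). The commuting graph of a finite non-commutative semigroup $S$ is the simple graph with vertex set $S\setminus Z(S)$, where $Z(S)$ is the center of $S$, and where distinct vertices $x,y$ are adjacent iff $xy=yx$. *)

(* Defs.v *)
From HB Require Import structures.
From mathcomp Require Import all_boot.

Set Implicit Arguments.
Unset Strict Implicit.
Unset Printing Implicit Defensive.

Local Open Scope group_scope.

#[short(type="finSemigroupType")]
HB.structure Definition FinSemigroup := {S of Semigroup S & Finite S}.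

Definition is_zero (S : semigroupType) (z : S) : Prop :=
  forall x : S, z * x = z /\ x * z = z.

(* Here and below, z is meant to be the zero of S. *)
Definition null_semigroup (S : semigroupType) (z : S) : Prop :=
  forall x y : S, x * y = z.

Definition is_ideal (S : semigroupType) (I : {pred S}) : Prop :=
  (exists x : S, x \in I) /\
  (forall s x : S, x \in I -> s * x \in I /\ x * s \in I).

Definition zero_simple (S : semigroupType) (z : S) : Prop :=
  ~ null_semigroup z /\
  (forall I : {pred S}, is_ideal I -> I =i pred1 z \/ I =i predT).

Definition idempotent_elt (S : semigroupType) (e : S) : Prop := e * e = e.

Definition idempotent_le (S : semigroupType) (e f : S) : Prop :=
  e * f = e /\ f * e = e.

Definition primitive_idempotent (S : semigroupType) (z e : S) : Prop :=
  [/\ idempotent_elt e, e <> z &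
      forall f : S,
        idempotent_elt f -> f <> z -> idempotent_le f e -> f = e].

Definition completely_zero_simple (S : semigroupType) : Prop :=
  exists z : S,
    [/\ is_zero z, zero_simple z & exists e : S, primitive_idempotent z e].

Definition noncommutative (S : semigroupType) : Prop :=
  ~ (forall x y : S, commute x y).

Record sgraph := SGraph {
  vertex : finType;
  adj : rel vertex;
  adj_sym : symmetric adj;
  adj_irrefl : irreflexive adj }.

Definition proper_coloring (G : sgraph) (k : nat)
    (c : {ffun vertex G -> 'I_k}) : bool :=
  [forall x, forall y, adj x y ==> (c x != c y)].

Definition colorable (G : sgraph) (k : nat) : bool :=
  [exists c : {ffun vertex G -> 'I_k}, proper_coloring c].

Lemma ex_colorable (G : sgraph) : exists k, colorable G k.
Proof.
exists #|vertex G|; apply/existsP; exists [ffun x => enum_rank x].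
apply/forallP => x; apply/forallP => y; apply/implyP.
by rewrite !ffunE (inj_eq enum_rank_inj); apply: contraTneq => ->; rewrite adj_irrefl.
Qed.

Definition chromatic_number (G : sgraph) : nat := ex_minn (ex_colorable G).

Definition semigroup_center (S : finSemigroupType) : {set S} :=
  [set x | [forall y, x * y == y * x]].

Definition noncentral (S : finSemigroupType) : finType :=
  {x : S | x \notin semigroup_center S}.

Definition commuting_adj (S : finSemigroupType) : rel (noncentral S) :=
  fun x y => (x != y) && (val x * val y == val y * val x).

Lemma commuting_adj_sym (S : finSemigroupType) : symmetric (@commuting_adj S).
Proof. by move=> x y; rewrite /commuting_adj eq_sym [X in _ && X]eq_sym. Qed.

Lemma commuting_adj_irrefl (S : finSemigroupType) :
  irreflexive (@commuting_adj S).
Proof. by move=> x; rewrite /commuting_adj eqxx. Qed.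

Definition commuting_graph (S : finSemigroupType) : sgraph :=
  SGraph (@commuting_adj_sym S) (@commuting_adj_irrefl S).

(* Main.v *)
(* Over the trivial group, distinct nonzero elements (i, l) and (j, m) of the
   Rees matrix semigroup with sandwich matrix P commute iff P l j = P m i = 0.
   Take two rows, one full of ones and the other zero except in one of its
   n + 1 columns: the n elements (i, l) with P l i = 0 form a clique and every
   other vertex is isolated, so n colours are needed and suffice. *)
Require Import Defs.
From HB Require Import structures.
From mathcomp Require Import all_boot.

Set Implicit Arguments.
Unset Strict Implicit.
Unset Printing Implicit Defensive.

Local Open Scope group_scope.

(** [None] is the zero. Indexing the type by [P] gives each sandwich matrix its own multiplication
    instance. *)
Definition rees (I L : finType) (P : L -> I -> bool) : Type := option (I * L).

Section Rees.
Variables (I L : finType) (P : L -> I -> bool).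

Definition rees_mul (x y : rees P) : rees P :=
  match x, y with
  | Some (i, l), Some (j, m) => if P l j then Some (i, m) else None
  | _, _ => None
  end.

Lemma rees_mulA : associative rees_mul.
Proof.
move=> [[i l]|] [[j m]|] [[k p]|] //=; last by case: ifP.
by case: ifP => Pmk; case: ifP => Plj //=; rewrite ?Pmk ?Plj.
Qed.

HB.instance Definition _ := Finite.copy (rees P) (option (I * L)).
HB.instance Definition _ := hasMul.Build (rees P) rees_mul.
HB.instance Definition _ := Magma_isSemigroup.Build (rees P) rees_mulA.

Lemma reesM (i j : I) (l m : L) :
  (Some (i, l) : rees P) * (Some (j, m) : rees P) =
  (if P l j then Some (i, m) else None).
Proof. by []. Qed.

Lemma rees_zero : is_zero (None : rees P).
Proof. by case=> [[i l]|]. Qed.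

(** Two nonzero products would be [(i, m)] and [(j, l)], equal only for equal factors; so the
    products agree only when both vanish. *)
Lemma rees_commute_neq (i j : I) (l m : L) :
  (i, l) != (j, m) ->
  ((Some (i, l) : rees P) * (Some (j, m) : rees P) ==
   (Some (j, m) : rees P) * (Some (i, l) : rees P)) = ~~ P l j && ~~ P m i.
Proof.
rewrite !reesM; case: (P l j); case: (P m i) => //= ne.
by apply: contra_neqF ne => /eqP [-> ->].
Qed.

Lemma rees_completely_zero_simple (l0 : L) :
  (forall l, exists i, P l i) -> (forall i, exists l, P l i) ->
  completely_zero_simple (rees P).
Proof.
move=> row col; have [i0 P0] := row l0; exists None; split.
- exact: rees_zero.
- split=> [null|J [[x0 Jx0] idJ]].
    by have := null (Some (i0, l0)) (Some (i0, l0)); rewrite reesM P0.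
  have J0 : None \in J by have [] := idJ None x0 Jx0.
  have [/existsP[[i l] Jil]|noJ] := boolP [exists p : I * L, Some p \in J].
    right=> -[[j m]|] //; rewrite !inE.
    (* From [(i, l)], left multiplication by [(j, m')] reaches [(j, l)], then right multiplication
       by [(i', m)] reaches [(j, m)]. *)
    have [m' Pm'i] := col i; have [i' Pli'] := row l.
    have [+ _] := idJ (Some (j, m')) _ Jil; rewrite reesM Pm'i => Jjl.
    by have [_] := idJ (Some (i', m)) _ Jjl; rewrite reesM Pli'.
  left=> -[p|]; rewrite !inE //.
  by apply: contraNF noJ => Jp; apply/existsP; exists p.
- exists (Some (i0, l0)); split=> //; first by rewrite /idempotent_elt reesM P0.
  (* For [f = (i, l)] below [e], [f * e = f] forces [l = l0] and [e * f = f] forces [i = i0]. *)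
  move=> [[i l]|] // _ _ []; rewrite !reesM.
  by case: ifP => // _ [->]; case: ifP => // _ [->].
Qed.

End Rees.

(** [None] is the exceptional column; [~~ i] reads [i] through [isSome]. *)
Definition clique_matrix (n : nat) (l : bool) (i : option 'I_n) : bool :=
  l || ~~ i.

Notation clique_rees n := (rees (@clique_matrix n)).

(** Both products are nonzero, with second coordinates [true] and [false]. *)
Lemma clique_rees_noncommute (n : nat) (k : option 'I_n) :
  (Some (k, false) : clique_rees n) * (Some (None, true) : clique_rees n) !=
  (Some (None, true) : clique_rees n) * (Some (k, false) : clique_rees n).
Proof. by rewrite !reesM; case: k. Qed.

Lemma clique_rees_noncentral (n : nat) (k : 'I_n) :
  (Some (Some k, false) : clique_rees n)
    \notin semigroup_center (clique_rees n : finSemigroupType).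
Proof.
rewrite inE negb_forall; apply/existsP; exists (Some (None, true)).
exact: clique_rees_noncommute.
Qed.

Lemma clique_rees_colorable (n : nat) :
  colorable (commuting_graph (clique_rees n.+1)) n.+1.
Proof.
apply/existsP.
(* Clique vertices get their own index; the rest are isolated, so any colour will do. *)
exists [ffun x => if val x is Some (Some k, _) then k else ord0].
apply/'forall_forallP => -[x Zx] [y Zy]; rewrite !ffunE /=.
apply/implyP => /andP[]; rewrite -val_eqE /=.
case: x Zx => [[i l]|] Zx; last first.
  by case/negP: Zx; rewrite inE; apply/forallP => -[[]|].
case: y Zy => [[j m]|] Zy; last first.
  by case/negP: Zy; rewrite inE; apply/forallP => -[[]|].
move=> ne; rewrite rees_commute_neq //.
(* Both entries vanish only for two clique vertices, whose indices then differ. *)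
case: i l j m ne {Zx Zy} => [i|] [] [j|] [] //= ne _.
by apply: contra_neq ne => ->.
Qed.

(** A proper colouring is injective on the clique of the [v i]. *)
Lemma clique_rees_color_bound (n k : nat) :
  colorable (commuting_graph (clique_rees n)) k -> n <= k.
Proof.
case/existsP=> c /'forall_forallP c_proper.
pose v (i : 'I_n) : vertex (commuting_graph (clique_rees n)) :=
  exist (fun x : clique_rees n => x \notin _) _ (clique_rees_noncentral i).
suff /leq_card : injective (c \o v) by rewrite !card_ord.
move=> i j /= /eqP; apply: contraTeq => ne.
apply: (implyP (c_proper (v i) (v j))).
have ne_ij : (Some i, false) != (Some j, false).
  by apply: contra_neq ne => -[].
by rewrite /= /commuting_adj -val_eqE /= rees_commute_neq // andbT.
Qed.

Theorem corollary9p5 :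
  forall n : nat, 0 < n ->
  exists S : finSemigroupType,
    [/\ noncommutative S, completely_zero_simple S &
        chromatic_number (commuting_graph S) = n].
Proof.
case=> // n _; exists (clique_rees n.+1); split.
- by move=> comm; case/eqP: (@clique_rees_noncommute n.+1 None); exact: comm.
(* Column [None] and row [true] are full. *)
- apply: (rees_completely_zero_simple true) => [l|i].
    by exists None; rewrite /clique_matrix orbT.
  by exists true.
rewrite /chromatic_number; case: ex_minnP => k colk mink.
apply/eqP; rewrite eqn_leq mink ?clique_rees_colorable //.
exact: clique_rees_color_bound.
Qed.
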